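(* The matrices of the Rota-Baxter operators of weights $0$ and $1$ on the two-dimensional complex evolution algebras $E_1$, $E_2$, $E_3$, $E_4$, $E_5(x,y)$ (with $x,y\in\mathbb C$, $xy\neq 1$), $E_6(x)$ (with $x\in\mathbb C$) defined in the context are given in the following two lists, which give all matrix forms of these operators. Here the matrix $\begin{pmatrix}a&b\\ c&d\end{pmatrix}$ stands for the linear map $P:E\to E$ with $P(e_1)=ae_1+be_2$, $P(e_2)=ce_1+de_2$; the parameters $a,b,c,d,x,y$ are in $\mathbb C$, subject to the stated restrictions; and $\omega=\sqrt[6]{-1}=e^{i\pi/6}$. (I) Matrices of the Rota-Baxter operators of weight $0$ on the evolution algebra: - $E_1$: $\begin{pmatrix}0&b\\0&d\end{pmatrix}$. - $E_2$: $\begin{pmatrix}0&0\\ c&-ic\end{pmatrix}$, $\begin{pmatrix}0&0\\ c&ic\end{pmatrix}$. - $E_3$: $\begin{pmatrix}a&a\\-a&-a\end{pmatrix}$, $\begin{pmatrix}a&-a\\-a&a\end{pmatrix}$. - $E_4$: $\begin{pmatrix}0&b\\0&d\end{pmatrix}$, $\begin{pmatrix}a&b\\0&\frac a2\end{pmatrix}$. - $E_5(\frac14,0)$: $\begin{pmatrix}a&\frac a2\\-2a&-a\end{pmatrix}$. - $E_5(0,\frac14)$: $\begin{pmatrix}a&2a\\-\frac a2&-a\end{pmatrix}$. - $E_5\left(\frac{(2a-b)b}{3a^2},\frac{-a^2+2ab}{3b^2}\right)$ with $a\ne0$, $b\neq0$, $a\neq 2b$, $b\ne 2a$, $a\neq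 -b$: $\begin{pmatrix}a&b\\-\frac{a^2}{b}&-a\end{pmatrix}$. - $E_6\left(-\frac{3b^2}{4c^2}\right)$ with $b\ne0$, $c\ne0$: $\begin{pmatrix}\frac{b^2}{2c}&b\\ c&\frac{-b^2}{2c}\end{pmatrix}$, where the parameters $b,c$ are solutions of the system $\frac{3b^6}{c}+16b^3c^2+16c^5=0$, $\ \frac{b^3}{c}+4c^2=0$. (II) Matrices of the Rota-Baxter operators of weight $1$ on the evolution algebra (an algebra may occur in several items, and then all the corresponding matrices are listed for it): - $E_1$: $\begin{pmatrix}-1&0\\0&d\end{pmatrix}$, $\begin{pmatrix}0&0\\0&d\end{pmatrix}$. - $E_2$: $\begin{pmatrix}0&0\\ c&ic\end{pmatrix}$, $\begin{pmatrix}0&0\\ c&-ic\end{pmatrix}$, $\begin{pmatrix}-\frac12&\frac i2\\-\frac i2&-\frac12\end{pmatrix}$, $\begin{pmatrix}-\frac12&-\frac i2\\ \frac i2&-\frac12\end{pmatrix}$, $\begin{pmatrix}-1&0\\ c&-1+ic\end{pmatrix}$, $\begin{pmatrix}-1&0\\ c&-1-ic\end{pmatrix}$. - $E_3$: $\begin{pmatrix}-1+b&b\\-b&-1-b\end{pmatrix}$, $\begin{pmatrix}-1-b&b\\ b&-1-b\end{pmatrix}$, $\begin{pmatrix}b&b\\-b&-b\end{pmatrix}$, $\begin{pmatrix}-b&b\\ b&-b\end{pmatrix}$. - $E_4$: $\begin{pmatrix}a&b\\0&\frac{a^2}{1+2a}\end{pmatrix}$, $a\neq-\frac12$. - $E_5(0,y)$: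 $\begin{pmatrix}0&0\\1&0\end{pmatrix}$, $\begin{pmatrix}0&0\\ c_{1,2}&-1\end{pmatrix}$, where $c_{1,2}=\frac{-1\pm\sqrt{1-4y}}2$. - $E_5(0,y)$ with $y\neq0$: $\begin{pmatrix}-1&0\\-1&-1\end{pmatrix}$, $\begin{pmatrix}-1&0\\ c_{1,2}&0\end{pmatrix}$, where $c_{1,2}=\frac{1\pm\sqrt{1-4y}}2$, $c_{1,2}\ne0$. - $E_5(0,y)$ with $y\ne0$, $y\neq\frac14$: $\begin{pmatrix}\frac{1-4y+\sqrt{1-4y}}{8y-2}&-\frac1{\sqrt{1-4y}}\\ \frac{y}{\sqrt{1-4y}}&\frac{1-4y-\sqrt{1-4y}}{8y-2}\end{pmatrix}$, $\begin{pmatrix}\frac{1-4y-\sqrt{1-4y}}{8y-2}&\frac1{\sqrt{1-4y}}\\-\frac{y}{\sqrt{1-4y}}&\frac{1-4y+\sqrt{1-4y}}{8y-2}\end{pmatrix}$. - $E_5(x,0)$: $\begin{pmatrix}0&1\\0&0\end{pmatrix}$, $\begin{pmatrix}0&b_{1,2}\\0&-1\end{pmatrix}$, $\begin{pmatrix}-1&-b_{1,2}\\0&0\end{pmatrix}$, $\begin{pmatrix}-1&-1\\0&-1\end{pmatrix}$, where $b_{1,2}=\frac{1\pm\sqrt{1-4x}}2$, $b_{1,2}\neq0$. - $E_5(x,0)$ with $x\ne0$, $x\neq\frac14$: $\begin{pmatrix}\frac{1-4x+\sqrt{1-4x}}{8x-2}&-\frac{x}{\sqrt{1-4x}}\\ \frac{1}{\sqrt{1-4x}}&\frac{1-4x-\sqrt{1-4x}}{8x-2}\end{pmatrix}$,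 $\begin{pmatrix}\frac{1-4x-\sqrt{1-4x}}{8x-2}&\frac{x}{\sqrt{1-4x}}\\-\frac{1}{\sqrt{1-4x}}&\frac{1-4x+\sqrt{1-4x}}{8x-2}\end{pmatrix}$. - $E_5(0,0)$: $\begin{pmatrix}-1&0\\0&0\end{pmatrix}$. - $E_5(x,y)$ (all $x,y$ with $xy\ne1$): $\begin{pmatrix}-1&0\\0&-1\end{pmatrix}$. - $E_5(x,1-x)$ with $x\neq\frac{1\pm i\sqrt3}2$: $\begin{pmatrix}\frac{-3-i\sqrt3}6&-\frac i{\sqrt3}\\ \frac i{\sqrt3}&\frac{-3+i\sqrt3}6\end{pmatrix}$, $\begin{pmatrix}\frac{-3+i\sqrt3}6&\frac i{\sqrt3}\\-\frac i{\sqrt3}&\frac{-3-i\sqrt3}6\end{pmatrix}$. - $E_5(x,y)$ with $x=\frac{d(1+d)(c+2cd-d(1+d))}{c^2(1+3d+3d^2)}$, $y=\frac{c(1-c+2d)}{1+3d+3d^2}$: $\begin{pmatrix}-1-d&-\frac{d(1+d)}c\\ c&d\end{pmatrix}$, where $d\ne0$, $d\neq-1$, $d\neq-\frac{3\pm i\sqrt3}6$, $c\neq0$, $c\neq\frac{d(1+d)}{1+2d}$, $c\neq1+2d$. - $E_6(0)$: $\begin{pmatrix}\frac{-3+i\sqrt3}6&0\\0&\frac{-3-i\sqrt3}6\end{pmatrix}$, $\begin{pmatrix}\frac{-3-i\sqrt3}6&0\\0&\frac{-3+i\sqrt3}6\end{pmatrix}$, $\begin{pmatrix}\frac{-3+i\sqrt3}6&-\frac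 i{\sqrt3}\\ \frac i{\sqrt3}&\frac{-3-i\sqrt3}6\end{pmatrix}$, $\begin{pmatrix}\frac{-3-i\sqrt3}6&\frac i{\sqrt3}\\-\frac i{\sqrt3}&\frac{-3+i\sqrt3}6\end{pmatrix}$, $\begin{pmatrix}\frac{-3-i\sqrt3}6&-\frac{\omega}{\sqrt3}\\ \frac{\omega^5}{\sqrt3}&\frac{-3+i\sqrt3}6\end{pmatrix}$, $\begin{pmatrix}\frac{-3+i\sqrt3}6&\frac{\omega}{\sqrt3}\\-\frac{\omega^5}{\sqrt3}&\frac{-3-i\sqrt3}6\end{pmatrix}$, $\begin{pmatrix}\frac{-3+i\sqrt3}6&\frac{\omega^5}{\sqrt3}\\-\frac{\omega}{\sqrt3}&\frac{-3-i\sqrt3}6\end{pmatrix}$, $\begin{pmatrix}\frac{-3-i\sqrt3}6&-\frac{\omega^5}{\sqrt3}\\ \frac{\omega}{\sqrt3}&\frac{-3+i\sqrt3}6\end{pmatrix}$. - $E_6(x)$ (all $x$): $\begin{pmatrix}-1&0\\0&-1\end{pmatrix}$. - $E_6\left(\frac{-b^3-c^3}{bc^2}\right)$ with $b\neq0$, $c\neq0$, $-b^3-c^3\neq0$: $\begin{pmatrix}\frac{b^2-c}{2c}&b\\ c&\frac{-b^2-c}{2c}\end{pmatrix}$, where the parameters $b,c$ are solutions of the system $\frac{b^6+5b^3c^3+4c^6}{c}=\frac{c(b^3+c^3)}{b}$, $\ \frac{b^4}{c}+4bc^2=c$.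
   Context: An evolution algebra over a field is an algebra with a basis $e_1,e_2,\dots$ such that $e_ie_j=0$ for $i\neq j$ and $e_ie_i=\sum_k a_{ik}e_k$. A Rota-Baxter operator of weight $\lambda\in\mathbb C$ on an evolution algebra $(E,\cdot)$ over $\mathbb C$ is a linear map $P:E\to E$ with $$P(x)\cdot P(y)=P\big(x\cdot P(y)+P(x)\cdot y+\lambda\, x\cdot y\big)\quad\text{for all }x,y\in E.$$ Any two-dimensional complex evolution algebra (with nonzero multiplication) is isomorphic to one of the following algebras with basis $e_1,e_2$ (products not listed, in particular $e_1e_2=e_2e_1$, are zero): $E_1$: $e_1e_1=e_1$; $E_2$: $e_1e_1=e_1$, $e_2e_2=e_1$; $E_3$: $e_1e_1=e_1+e_2$, $e_2e_2=-e_1-e_2$; $E_4$: $e_1e_1=e_2$; $E_5(x,y)$: $e_1e_1=e_1+xe_2$, $e_2e_2=ye_1+e_2$, with $x,y\in\mathbb C$, $1-xy\neq0$ (this condition is in force wherever $E_5(x,y)$ is mentioned); $E_6(x)$: $e_1e_1=e_2$, $e_2e_2=e_1+xe_2$, with $x\in\mathbb C$. In items containing $\pm$ or the subscript $1,2$, both choices are meant.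
   Formalization: The lists are not complete as written: the zero operator is added for every algebra in both weights, and for weight 1 on E_5(0,0) the two missing matrices (-1 0; -1 -1) and (-1 0; 1 0) are added. *)

(* Defs.v *)
From HB Require Import structures.
From mathcomp Require Import all_boot all_order all_algebra.
From mathcomp Require Import all_classical all_reals all_analysis.
From mathcomp Require Export complex.

Set Implicit Arguments.
Unset Strict Implicit.
Unset Printing Implicit Defensive.

Import Order.TTheory GRing.Theory Num.Theory.
Local Open Scope ring_scope.

(* The algebra on 'rV_n whose natural basis e_i = delta_mx 0 i satisfies
   e_i e_i = row i A and e_i e_j = 0 for i != j. *)
Definition evolution_mul (K : fieldType) (n : nat) (A : 'M[K]_n)
  (u v : 'rV[K]_n) : 'rV[K]_n :=
  \sum_(i < n) (u 0 i * v 0 i) *: row i A.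

Definition rota_baxter (K : fieldType) (V : lmodType K) (mul : V -> V -> V)
  (lambda : K) (P : {linear V -> V}) : Prop :=
  forall x y : V,
    mul (P x) (P y) = P (mul x (P y) + mul (P x) y + lambda *: mul x y).

Definition mx2 (K : fieldType) (a b c d : K) : 'M[K]_2 :=
  \matrix_(i < 2, j < 2)
    (if i == 0 then if j == 0 then a else b else if j == 0 then c else d).

Inductive evolution_algebra (R : realType) : Type :=
| E1 | E2 | E3 | E4 | E5 of R[i] & R[i] | E6 of R[i].

Arguments E1 {R}.
Arguments E2 {R}.
Arguments E3 {R}.
Arguments E4 {R}.

Definition admissible (R : realType) (E : evolution_algebra R) : Prop :=
  if E is E5 x y then x * y != 1 else True.

Definition structure_mx (R : realType) (E : evolution_algebra R) :
  'M[R[i]]_2 :=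
  match E with
  | E1 => mx2 1 0 0 0
  | E2 => mx2 1 0 1 0
  | E3 => mx2 1 1 (-1) (-1)
  | E4 => mx2 0 1 0 0
  | E5 x y => mx2 1 x y 1
  | E6 x => mx2 0 1 1 x
  end.

(* e^(i pi / 6) *)
Definition omega (R : realType) : R[i] :=
  Complex (cos (pi / 6)) (sin (pi / 6)).

(* In both lists the matrix mx2 a b c d stands for the map with
   P(e_1) = a e_1 + b e_2 and P(e_2) = c e_1 + d e_2, i.e. for u |-> u *m M on
   row vectors.  sqrtC is the principal square root; a sign +/- is rendered by
   the two alternatives. *)
Inductive weight0_list (R : realType) :
  evolution_algebra R -> 'M[R[i]]_2 -> Prop :=
| W0_E1 b d : weight0_list E1 (mx2 0 b 0 d)
| W0_E2_1 c : weight0_list E2 (mx2 0 0 c (- 'i * c))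
| W0_E2_2 c : weight0_list E2 (mx2 0 0 c ('i * c))
| W0_E3_1 a : weight0_list E3 (mx2 a a (- a) (- a))
| W0_E3_2 a : weight0_list E3 (mx2 a (- a) (- a) a)
| W0_E4_1 b d : weight0_list E4 (mx2 0 b 0 d)
| W0_E4_2 a b : weight0_list E4 (mx2 a b 0 (a / 2))
| W0_E5_1 a : weight0_list (E5 (1 / 4) 0) (mx2 a (a / 2) (- 2 * a) (- a))
| W0_E5_2 a : weight0_list (E5 0 (1 / 4)) (mx2 a (2 * a) (- (a / 2)) (- a))
| W0_E5_3 a b :
    a != 0 -> b != 0 -> a != 2 * b -> b != 2 * a -> a != - b ->
    weight0_list
      (E5 ((2 * a - b) * b / (3 * a ^+ 2))
          ((- a ^+ 2 + 2 * a * b) / (3 * b ^+ 2)))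
      (mx2 a b (- (a ^+ 2 / b)) (- a))
| W0_E6 b c :
    b != 0 -> c != 0 ->
    3 * b ^+ 6 / c + 16 * b ^+ 3 * c ^+ 2 + 16 * c ^+ 5 = 0 ->
    b ^+ 3 / c + 4 * c ^+ 2 = 0 ->
    weight0_list
      (E6 (- (3 * b ^+ 2 / (4 * c ^+ 2))))
      (mx2 (b ^+ 2 / (2 * c)) b c (- b ^+ 2 / (2 * c))).

Inductive weight1_list (R : realType) :
  evolution_algebra R -> 'M[R[i]]_2 -> Prop :=
| W1_E1_1 d : weight1_list E1 (mx2 (-1) 0 0 d)
| W1_E1_2 d : weight1_list E1 (mx2 0 0 0 d)
| W1_E2_1 c : weight1_list E2 (mx2 0 0 c ('i * c))
| W1_E2_2 c : weight1_list E2 (mx2 0 0 c (- 'i * c))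
| W1_E2_3 :
    weight1_list E2 (mx2 (- (1 / 2)) ('i / 2) (- ('i / 2)) (- (1 / 2)))
| W1_E2_4 :
    weight1_list E2 (mx2 (- (1 / 2)) (- ('i / 2)) ('i / 2) (- (1 / 2)))
| W1_E2_5 c : weight1_list E2 (mx2 (-1) 0 c (-1 + 'i * c))
| W1_E2_6 c : weight1_list E2 (mx2 (-1) 0 c (-1 - 'i * c))
| W1_E3_1 b : weight1_list E3 (mx2 (-1 + b) b (- b) (-1 - b))
| W1_E3_2 b : weight1_list E3 (mx2 (-1 - b) b b (-1 - b))
| W1_E3_3 b : weight1_list E3 (mx2 b b (- b) (- b))
| W1_E3_4 b : weight1_list E3 (mx2 (- b) b b (- b))
| W1_E4 a b :
    a != - (1 / 2) ->
    weight1_list E4 (mx2 a b 0 (a ^+ 2 / (1 + 2 * a)))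
| W1_E5_0y_1 y : weight1_list (E5 0 y) (mx2 0 0 1 0)
| W1_E5_0y_2 y c :
    c = (-1 + sqrtC (1 - 4 * y)) / 2 \/ c = (-1 - sqrtC (1 - 4 * y)) / 2 ->
    weight1_list (E5 0 y) (mx2 0 0 c (-1))
| W1_E5_0y_3 y :
    y != 0 ->
    weight1_list (E5 0 y) (mx2 (-1) 0 (-1) (-1))
| W1_E5_0y_4 y c :
    y != 0 ->
    c = (1 + sqrtC (1 - 4 * y)) / 2 \/ c = (1 - sqrtC (1 - 4 * y)) / 2 ->
    c != 0 ->
    weight1_list (E5 0 y) (mx2 (-1) 0 c 0)
| W1_E5_0y_5 y :
    y != 0 -> y != 1 / 4 ->
    weight1_list (E5 0 y)
      (mx2 ((1 - 4 * y + sqrtC (1 - 4 * y)) / (8 * y - 2))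
           (- (1 / sqrtC (1 - 4 * y)))
           (y / sqrtC (1 - 4 * y))
           ((1 - 4 * y - sqrtC (1 - 4 * y)) / (8 * y - 2)))
| W1_E5_0y_6 y :
    y != 0 -> y != 1 / 4 ->
    weight1_list (E5 0 y)
      (mx2 ((1 - 4 * y - sqrtC (1 - 4 * y)) / (8 * y - 2))
           (1 / sqrtC (1 - 4 * y))
           (- (y / sqrtC (1 - 4 * y)))
           ((1 - 4 * y + sqrtC (1 - 4 * y)) / (8 * y - 2)))
| W1_E5_x0_1 x : weight1_list (E5 x 0) (mx2 0 1 0 0)
| W1_E5_x0_2 x b :
    b = (1 + sqrtC (1 - 4 * x)) / 2 \/ b = (1 - sqrtC (1 - 4 * x)) / 2 ->
    b != 0 ->
    weight1_list (E5 x 0) (mx2 0 b 0 (-1))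
| W1_E5_x0_3 x b :
    b = (1 + sqrtC (1 - 4 * x)) / 2 \/ b = (1 - sqrtC (1 - 4 * x)) / 2 ->
    b != 0 ->
    weight1_list (E5 x 0) (mx2 (-1) (- b) 0 0)
| W1_E5_x0_4 x : weight1_list (E5 x 0) (mx2 (-1) (-1) 0 (-1))
| W1_E5_x0_5 x :
    x != 0 -> x != 1 / 4 ->
    weight1_list (E5 x 0)
      (mx2 ((1 - 4 * x + sqrtC (1 - 4 * x)) / (8 * x - 2))
           (- (x / sqrtC (1 - 4 * x)))
           (1 / sqrtC (1 - 4 * x))
           ((1 - 4 * x - sqrtC (1 - 4 * x)) / (8 * x - 2)))
| W1_E5_x0_6 x :
    x != 0 -> x != 1 / 4 ->
    weight1_list (E5 x 0)
      (mx2 ((1 - 4 * x - sqrtC (1 - 4 * x)) / (8 * x - 2))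
           (x / sqrtC (1 - 4 * x))
           (- (1 / sqrtC (1 - 4 * x)))
           ((1 - 4 * x + sqrtC (1 - 4 * x)) / (8 * x - 2)))
| W1_E5_00 : weight1_list (E5 0 0) (mx2 (-1) 0 0 0)
| W1_E5_xy x y : weight1_list (E5 x y) (mx2 (-1) 0 0 (-1))
| W1_E5_diag_1 x :
    x != (1 + 'i * sqrtC 3) / 2 -> x != (1 - 'i * sqrtC 3) / 2 ->
    weight1_list (E5 x (1 - x))
      (mx2 ((- 3 - 'i * sqrtC 3) / 6) (- ('i / sqrtC 3))
           ('i / sqrtC 3) ((- 3 + 'i * sqrtC 3) / 6))
| W1_E5_diag_2 x :
    x != (1 + 'i * sqrtC 3) / 2 -> x != (1 - 'i * sqrtC 3) / 2 ->
    weight1_list (E5 x (1 - x))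
      (mx2 ((- 3 + 'i * sqrtC 3) / 6) ('i / sqrtC 3)
           (- ('i / sqrtC 3)) ((- 3 - 'i * sqrtC 3) / 6))
(* For d = -1/2 the condition c != d (1 + d) / (1 + 2 d) has no content: it
   then reads c != 0 because division by zero yields zero. *)
| W1_E5_gen c d :
    d != 0 -> d != -1 ->
    d != - ((3 + 'i * sqrtC 3) / 6) -> d != - ((3 - 'i * sqrtC 3) / 6) ->
    c != 0 -> c != d * (1 + d) / (1 + 2 * d) -> c != 1 + 2 * d ->
    weight1_list
      (E5 (d * (1 + d) * (c + 2 * c * d - d * (1 + d))
             / (c ^+ 2 * (1 + 3 * d + 3 * d ^+ 2)))
          (c * (1 - c + 2 * d) / (1 + 3 * d + 3 * d ^+ 2)))
      (mx2 (-1 - d) (- (d * (1 + d) / c)) c d)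
| W1_E6_0_1 :
    weight1_list (E6 0)
      (mx2 ((- 3 + 'i * sqrtC 3) / 6) 0 0 ((- 3 - 'i * sqrtC 3) / 6))
| W1_E6_0_2 :
    weight1_list (E6 0)
      (mx2 ((- 3 - 'i * sqrtC 3) / 6) 0 0 ((- 3 + 'i * sqrtC 3) / 6))
| W1_E6_0_3 :
    weight1_list (E6 0)
      (mx2 ((- 3 + 'i * sqrtC 3) / 6) (- ('i / sqrtC 3))
           ('i / sqrtC 3) ((- 3 - 'i * sqrtC 3) / 6))
| W1_E6_0_4 :
    weight1_list (E6 0)
      (mx2 ((- 3 - 'i * sqrtC 3) / 6) ('i / sqrtC 3)
           (- ('i / sqrtC 3)) ((- 3 + 'i * sqrtC 3) / 6))
| W1_E6_0_5 :
    weight1_list (E6 0)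
      (mx2 ((- 3 - 'i * sqrtC 3) / 6) (- (omega R / sqrtC 3))
           (omega R ^+ 5 / sqrtC 3) ((- 3 + 'i * sqrtC 3) / 6))
| W1_E6_0_6 :
    weight1_list (E6 0)
      (mx2 ((- 3 + 'i * sqrtC 3) / 6) (omega R / sqrtC 3)
           (- (omega R ^+ 5 / sqrtC 3)) ((- 3 - 'i * sqrtC 3) / 6))
| W1_E6_0_7 :
    weight1_list (E6 0)
      (mx2 ((- 3 + 'i * sqrtC 3) / 6) (omega R ^+ 5 / sqrtC 3)
           (- (omega R / sqrtC 3)) ((- 3 - 'i * sqrtC 3) / 6))
| W1_E6_0_8 :
    weight1_list (E6 0)
      (mx2 ((- 3 - 'i * sqrtC 3) / 6) (- (omega R ^+ 5 / sqrtC 3))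
           (omega R / sqrtC 3) ((- 3 + 'i * sqrtC 3) / 6))
| W1_E6_x x : weight1_list (E6 x) (mx2 (-1) 0 0 (-1))
| W1_E6_gen b c :
    b != 0 -> c != 0 -> - b ^+ 3 - c ^+ 3 != 0 ->
    (b ^+ 6 + 5 * b ^+ 3 * c ^+ 3 + 4 * c ^+ 6) / c
      = c * (b ^+ 3 + c ^+ 3) / b ->
    b ^+ 4 / c + 4 * b * c ^+ 2 = c ->
    weight1_list
      (E6 ((- b ^+ 3 - c ^+ 3) / (b * c ^+ 2)))
      (mx2 ((b ^+ 2 - c) / (2 * c)) b c ((- b ^+ 2 - c) / (2 * c))).

(* Two Rota-Baxter operators of weight 1 on E5 0 0 that weight1_list lists only
   after exchanging e_1 and e_2 (an automorphism of E5 0 0), as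
   mx2 (-1) (-1) 0 (-1) and mx2 0 1 0 (-1). *)
Inductive weight1_list_swapped (R : realType) :
  evolution_algebra R -> 'M[R[i]]_2 -> Prop :=
| W1s_E5_00_1 : weight1_list_swapped (E5 0 0) (mx2 (-1) 0 (-1) (-1))
| W1s_E5_00_2 : weight1_list_swapped (E5 0 0) (mx2 (-1) 0 1 0).

(* Main.v *)
Require Import Defs.
From mathcomp Require Import all_boot all_order all_algebra.
From mathcomp Require Import all_classical all_reals all_analysis.
From mathcomp Require Import ring lra.
Import GRing.Theory Num.Theory.
Local Open Scope ring_scope.

(* On the natural basis the Rota-Baxter identity is a system of six quadratic
   equations in the entries of the matrix M of P.  For E5 and non-diagonal M,
   conjugating M by the (invertible) structure matrix preserves the trace, and
   this forces tr M = - l and det M = 0; the system is then linear in the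
   structure constants x and y, which gives the rational parametrisation, with
   the diagonal family at the zeros of its denominator.  For E6 the system is
   triangular once c != 0. *)

Set Implicit Arguments.
Unset Strict Implicit.

(** By Cayley-Hamilton, trace [- l] and determinant 0 mean M^2 = - l M: in weight 0 the map squares
    to zero, in weight 1 its negative is a projection. The denominators of the [E5] families come
    from l^2 - 3 a d, which is 3 a^2 in weight 0 and 1 + 3 d + 3 d^2 in weight 1. The trace argument
    needs b and c both nonzero and an invertible structure matrix. Triangular matrices are therefore
    solved by hand, and [E1] to [E4], whose structure matrices are singular, are treated directly.
    Eliminations are certificates: an explicit combination of known equations is checked by [ring],
    and nonzero factors are cancelled with [mulfI]. *)

(** Taking the proof as an argument lets a certificate name a hypothesis and recover both sides from
    its type. *)
Definition gap (K : zmodType) (l r : K) (_ : l = r) : K := l - r.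

Lemma gap0 (K : zmodType) (l r : K) (e : l = r) : gap e = 0.
Proof. by rewrite /gap e subrr. Qed.

Lemma eq_combination (K : zmodType) (t l r : K) : t = 0 -> l - r = t -> l = r.
Proof. by move=> -> /eqP; rewrite subr_eq0 => /eqP. Qed.

(* Proves [l = r] by exhibiting [l - r] as the combination [t] of the gaps of
   known equations. *)
Ltac lincomb t :=
  apply: (@eq_combination _ t);
  [by rewrite !gap0 ?(mulr0, oppr0, addr0) | by rewrite /gap; ring].

(** * The identity as six equations, and the trace argument *)

(** Coordinates of the identity on the pairs (e_1, e_1), (e_1, e_2), (e_2, e_2), two for each in
    this order; (p, q) and (r, s) are e_1 e_1 and e_2 e_2. The mixed pair carries no [l] because e_1
    e_2 = 0. *)
Definition rota_baxter_eqs (K : pzRingType) (p q r s l a b c d : K) : Prop :=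
  [/\ a ^+ 2 * p + b ^+ 2 * r = (2 * a + l) * (p * a + q * c),
      a ^+ 2 * q + b ^+ 2 * s = (2 * a + l) * (p * b + q * d)
    & a * c * p + b * d * r = c * (p * a + q * c) + b * (r * a + s * c)] /\
  [/\ a * c * q + b * d * s = c * (p * b + q * d) + b * (r * b + s * d),
      c ^+ 2 * p + d ^+ 2 * r = (2 * d + l) * (r * a + s * c)
    & c ^+ 2 * q + d ^+ 2 * s = (2 * d + l) * (r * b + s * d)].

Lemma big_ord2 (V : nmodType) (F : 'I_2 -> V) : \sum_(i < 2) F i = F 0 + F 1.
Proof.
rewrite !big_ord_recl big_ord0 addr0.
by congr (F _ + F _); apply: val_inj.
Qed.

Lemma mx2E (K : fieldType) (a b c d : K) :
  (mx2 a b c d 0 0 = a) * (mx2 a b c d 0 1 = b) *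
  (mx2 a b c d 1 0 = c) * (mx2 a b c d 1 1 = d).
Proof. by rewrite /mx2 !mxE. Qed.

Lemma mx2_eta (K : fieldType) (M : 'M[K]_2) :
  M = mx2 (M 0 0) (M 0 1) (M 1 0) (M 1 1).
Proof.
by apply/matrixP => -[[|[|i]] /= hi] [[|[|j]] /= hj] //;
  rewrite ?mxE /=; congr (M _ _); apply: val_inj.
Qed.

Lemma mx2_0 (K : fieldType) : mx2 0 0 0 0 = 0 :> 'M[K]_2.
Proof. by apply/matrixP => i j; rewrite !mxE !if_same. Qed.

(** Both sides of the identity are bilinear and, the product being commutative, symmetric, so three
    pairs of basis vectors suffice; (e_2, e_1) repeats (e_1, e_2). *)
Lemma rota_baxterE (K : fieldType) (p q r s l a b c d : K)
    (P : {linear 'rV[K]_2 -> 'rV[K]_2}) : lin1_mx P = mx2 a b c d ->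
  rota_baxter (evolution_mul (mx2 p q r s)) l P <->
  rota_baxter_eqs p q r s l a b c d.
Proof.
move=> PE.
have P0 u : P u 0 0 = u 0 0 * a + u 0 1 * c.
  by rewrite -mul_rV_lin1 PE mxE big_ord2 !mx2E.
have P1 u : P u 0 1 = u 0 0 * b + u 0 1 * d.
  by rewrite -mul_rV_lin1 PE mxE big_ord2 !mx2E.
have m0 u v : evolution_mul (mx2 p q r s) u v 0 0
    = u 0 0 * v 0 0 * p + u 0 1 * v 0 1 * r.
  rewrite /evolution_mul big_ord2 !mxE.
  by rewrite -/(mx2 p q r s) /=.
have m1 u v : evolution_mul (mx2 p q r s) u v 0 1
    = u 0 0 * v 0 0 * q + u 0 1 * v 0 1 * s.
  rewrite /evolution_mul big_ord2 !mxE.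
  by rewrite -/(mx2 p q r s) /=.
have addE (u v : 'rV[K]_2) j : (u + v) 0 j = u 0 j + v 0 j by rewrite mxE.
have scaleE k (u : 'rV[K]_2) j : (k *: u) 0 j = k * u 0 j by rewrite mxE.
have rowE2 (u v : 'rV[K]_2) : u 0 0 = v 0 0 -> u 0 1 = v 0 1 -> u = v.
  move=> h0 h1; apply/rowP => -[[|[|j]] //= hj].
    by rewrite [Ordinal _](_ : _ = 0) //; apply: val_inj.
  by rewrite [Ordinal _](_ : _ = 1) //; apply: val_inj.
pose E := (P0, P1, m0, m1, addE, scaleE).
split=> [rb | [[e1 e2 e3] [e4 e5 e6]] u v].
  pose e j : 'rV[K]_2 := delta_mx 0 j.
  have eE : (e 0 0 0 = 1) * (e 0 0 1 = 0) * (e 1 0 0 = 0) * (e 1 0 1 = 1).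
    by rewrite !mxE.
  have rb0 i j := congr1 (fun w : 'rV[K]_2 => w 0 0) (rb (e i) (e j)).
  have rb1 i j := congr1 (fun w : 'rV[K]_2 => w 0 1) (rb (e i) (e j)).
  have := (rb0 0 0, rb1 0 0, (rb0 0 1, rb1 0 1), (rb0 1 1, rb1 1 1)).
  rewrite /= !E !eE => -[[[e1 e2] [e3 e4]] [e5 e6]].
  split; split.
  - lincomb (gap e1).
  - lincomb (gap e2).
  - lincomb (gap e3).
  - lincomb (gap e4).
  - lincomb (gap e5).
  - lincomb (gap e6).
apply: rowE2; rewrite !E.
  lincomb (u 0 0 * v 0 0 * gap e1 + u 0 1 * v 0 1 * gap e5
    + (u 0 0 * v 0 1 + u 0 1 * v 0 0) * gap e3).
lincomb (u 0 0 * v 0 0 * gap e2 + u 0 1 * v 0 1 * gap e6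
    + (u 0 0 * v 0 1 + u 0 1 * v 0 0) * gap e4).
Qed.

(** Exchanging e_1 and e_2 reverses the entries of both matrices and the order of the equations. For
    [E5] this reduces [b = 0] to [c = 0], and [E5 x 0] to [E5 0 y]. *)
Lemma rota_baxter_eqs_swap (K : comPzRingType) (p q r s l a b c d : K) :
  rota_baxter_eqs p q r s l a b c d -> rota_baxter_eqs s r q p l d c b a.
Proof.
move=> [[e1 e2 e3] [e4 e5 e6]]; split; split.
- lincomb (gap e6).
- lincomb (gap e5).
- lincomb (gap e4).
- lincomb (gap e3).
- lincomb (gap e2).
- lincomb (gap e1).
Qed.

(* In the notation of row vectors the equations for [M = mx2 a b c d] become,
   with [N = A *m M *m invmx A], the conditions
     (a^2, b^2) = (2 a + l) N_1, (c^2, d^2) = (2 d + l) N_2,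
     (a c, b d) = (c, b) N.
   They determine the diagonal of [N], and comparing its trace with that of
   [M] yields the two relations. *)
Lemma rota_baxter_eqs_nondiag (K : numFieldType) (p q r s l a b c d : K) :
  p * s - q * r != 0 -> b != 0 -> c != 0 ->
  rota_baxter_eqs p q r s l a b c d -> a + d = - l /\ a * d = b * c.
Proof.
move=> D0 b0 c0 [[e1 e2 e3] [e4 e5 e6]].
pose D := p * s - q * r.
have [t tE] : exists t, t = 2 * a + l by exists (2 * a + l).
have [u uE] : exists u, u = 2 * d + l by exists (2 * d + l).
rewrite -/D in D0; rewrite -tE in e1 e2; rewrite -uE in e5 e6.
(* By Cramer, [A], [B], [C], [F] are the entries of N times the determinant [D], which avoids
   division. This local [A] is an entry, not the structure matrix. *)
pose A := s * (p * a + q * c) - r * (p * b + q * d).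
pose B := p * (p * b + q * d) - q * (p * a + q * c).
pose C := s * (r * a + s * c) - r * (r * b + s * d).
pose F := p * (r * b + s * d) - q * (r * a + s * c).
have f1 : a ^+ 2 * D = t * A.
  by rewrite /D /A; lincomb (s * gap e1 - r * gap e2).
have f2 : b ^+ 2 * D = t * B.
  by rewrite /D /B; lincomb (p * gap e2 - q * gap e1).
have f5 : c ^+ 2 * D = u * C.
  by rewrite /D /C; lincomb (s * gap e5 - r * gap e6).
have f6 : d ^+ 2 * D = u * F.
  by rewrite /D /F; lincomb (p * gap e6 - q * gap e5).
have f3 : a * c * D = c * A + b * C.
  by rewrite /D /A /C; lincomb (s * gap e3 - r * gap e4).
have f4 : b * d * D = c * B + b * F.
  by rewrite /D /B /F; lincomb (p * gap e4 - q * gap e3).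
have tr : A + F = D * (a + d) by rewrite /A /F /D; ring.
clearbody A B C F D; clear e1 e2 e3 e4 e5 e6.
have t0 : t != 0.
  apply: contra_neq b0 => t0.
  move/eqP: f2; rewrite t0 mul0r mulf_eq0 (negPf D0) orbF.
  by rewrite expf_eq0 /= => /eqP.
have u0 : u != 0.
  apply: contra_neq c0 => u0.
  move/eqP: f5; rewrite u0 mul0r mulf_eq0 (negPf D0) orbF.
  by rewrite expf_eq0 /= => /eqP.
(* Multiplying [f3] by [t * u] turns [t * A] and [u * C] into known squares; the same with [f4] and
   [tr] eliminates N altogether. *)
have g1 : u * (a * (t - a)) = b * t * c.
  apply: (mulfI (mulf_neq0 c0 D0)).
  lincomb (t * u * gap f3 - c * u * gap f1 - b * t * gap f5).
have g2 : t * (d * (u - d)) = b * u * c.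
  apply: (mulfI (mulf_neq0 b0 D0)).
  lincomb (t * u * gap f4 - c * u * gap f2 - b * t * gap f6).
have g3 : t * u * (a + d) = u * a ^+ 2 + t * d ^+ 2.
  apply: (mulfI D0).
  lincomb (- t * u * gap tr - u * gap f1 - t * gap f6).
(* Adding [g1] and [g2] and using [g3] leaves b c (t + u) = 0, and t + u is 2 (a + d + l). *)
have g4 : u + t = 0.
  apply: (mulfI (mulf_neq0 b0 c0)).
  lincomb (gap g3 - gap g1 - gap g2).
have two0 : (2 : K) != 0 by rewrite pnatr_eq0.
have g5 : a + d = - l.
  by apply: (mulfI two0); lincomb (gap g4 - gap tE - gap uE).
split=> //.
apply: (mulfI t0).
lincomb (gap g1 + a * d * gap g4 - a * u * gap tE - a * u * gap g5).
Qed.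

(** * Solving the equations for [E3], [E5] and [E6] *)

Section Solutions.
Variable K : numFieldType.
Implicit Types p q r s x y l a b c d : K.

Let n2 : (2 : K) != 0. Proof. by rewrite pnatr_eq0. Qed.
Let n3 : (3 : K) != 0. Proof. by rewrite pnatr_eq0. Qed.

Lemma mulf_eq0P a b : a * b = 0 -> a = 0 \/ b = 0.
Proof. by move/eqP; rewrite mulf_eq0 => /orP[]/eqP; [left|right]. Qed.

Lemma sqrf_eq0P a : a ^+ 2 = 0 -> a = 0.
Proof. by move/eqP; rewrite sqrf_eq0 => /eqP. Qed.

Lemma eqf_sqrP a b : a ^+ 2 = b ^+ 2 -> a = b \/ a = - b.
Proof. by move/eqP; rewrite eqf_sqr => /orP[]/eqP; [left|right]. Qed.

Lemma eq_divf a b c : c != 0 -> c * a = b -> a = b / c.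
Proof. by move=> c0 <-; rewrite mulrAC divff ?mul1r. Qed.

(** Every product is a multiple of e_1 + e_2, so the two equations of each pair differ by a factor
    times a + c - b - d, the difference of the coordinates of P(e_1 + e_2). The factors 2 a + l, c -
    b, 2 d + l combine to 2 (a + c - b - d), whose square thus vanishes. *)
Lemma rota_baxter_eqs_E3 l a b c d : rota_baxter_eqs 1 1 (-1) (-1) l a b c d ->
  [\/ [/\ c = b, d = a & a = - b], [/\ c = b, d = a & a = - l - b],
      [/\ c = - b, d = - b & a = b] | [/\ c = - b, d = - l - b & a = - l + b]].
Proof.
move=> [[e1 e2 e3] [e4 e5 e6]].
have g0 : 2 * (a + c - b - d) = 0.
  apply: sqrf_eq0P.
  lincomb (2 * (gap e2 - gap e1) + 2 * (gap e6 - gap e5)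
    + 4 * (gap e4 - gap e3)).
have dE : d = a + c - b by apply: (mulfI n2); lincomb (- gap g0).
have [cE|cE] : c = b \/ c = - b.
  by apply: eqf_sqrP; lincomb (- gap e4 - c * gap dE).
  have da : d = a by lincomb (gap dE + gap cE).
  have [h|h] : a + b = 0 \/ a + b + l = 0.
    apply: mulf_eq0P; lincomb (- gap e1 + (- (2 * a + l)) * gap cE).
  - by apply: Or41; split=> //; lincomb (gap h).
  - by apply: Or42; split=> //; lincomb (gap h).
have da : d = a - 2 * b by lincomb (gap dE + gap cE).
have [h|h] : a - b = 0 \/ a - b + l = 0.
  apply: mulf_eq0P; lincomb (- gap e1 - (2 * a + l) * gap cE).
- by apply: Or43; split=> //; [lincomb (gap da + gap h)|lincomb (gap h)].
- by apply: Or44; split=> //; [lincomb (gap da + gap h)|lincomb (gap h)].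
Qed.

Lemma rota_baxter_eqs_E5_upper0 x y a b d : rota_baxter_eqs 1 x y 1 0 a b 0 d ->
  [/\ a = 0, b = 0 & d = 0].
Proof.
move=> [[e1 e2 _] [e4 _ e6]].
have a0 : a = 0 by apply: sqrf_eq0P; lincomb (- gap e1 - gap e4).
have b0 : b = 0 by apply: sqrf_eq0P; rewrite a0 in e2; lincomb (gap e2).
by split=> //; apply: sqrf_eq0P; rewrite b0 in e6; lincomb (- gap e6).
Qed.

(** With c = 0, [e4] says y b^2 = 0, so [b] can be nonzero only if y = 0. In that case a and d each
    lie in {0, -1}, and [e2] links b to x. *)
Lemma rota_baxter_eqs_E5_upper1 x y a b d : rota_baxter_eqs 1 x y 1 1 a b 0 d ->
  [\/ [/\ a = 0, b = 0 & d = 0], [/\ a = -1, b = 0 & d = -1] |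
      y = 0 /\ [\/ [/\ a = 0, b = 1 & d = 0],
                   [/\ a = 0, d = -1 & x = b - b ^+ 2],
                   [/\ a = -1, d = 0 & x = - b - b ^+ 2] |
                   [/\ a = -1, b = -1 & d = -1]]].
Proof.
move=> [[e1 e2 e3] [e4 e5 e6]].
have [y0|y0] := eqVneq y 0.
- have [a0|a1] : a = 0 \/ a + 1 = 0.
  + by apply: mulf_eq0P; rewrite y0 in e1; lincomb (- gap e1).
  + have [d0|d1] : d = 0 \/ d + 1 = 0.
    * by apply: mulf_eq0P; rewrite y0 in e6; lincomb (- gap e6).
    * rewrite a0 d0 in e2 *.
      have [b0|b1] : b = 0 \/ b - 1 = 0 by apply: mulf_eq0P; lincomb (gap e2).
        by apply: Or31.
      by apply: Or33; split=> //; apply: Or41; split=> //; lincomb (gap b1).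
    * have dE : d = -1 by lincomb (gap d1).
      rewrite a0 dE in e2 *; apply: Or33; split=> //; apply: Or42; split=> //.
      lincomb (gap e2).
  + have aE : a = -1 by lincomb (gap a1).
    have [d0|d1] : d = 0 \/ d + 1 = 0.
    * by apply: mulf_eq0P; rewrite y0 in e6; lincomb (- gap e6).
    * rewrite aE d0 in e2 *; apply: Or33; split=> //; apply: Or43; split=> //.
      lincomb (gap e2).
    * have dE : d = -1 by lincomb (gap d1).
      rewrite aE dE in e2 *.
      have [b0|b1] : b = 0 \/ b + 1 = 0 by apply: mulf_eq0P; lincomb (gap e2).
        by apply: Or32.
      by apply: Or33; split=> //; apply: Or44; split=> //; lincomb (gap b1).
- have b0 : b = 0.
    by apply: sqrf_eq0P; apply: (mulfI y0); lincomb (- gap e4).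
  rewrite b0 in e1 e5 *.
  have [a0|a1] : a = 0 \/ a + 1 = 0 by apply: mulf_eq0P; lincomb (- gap e1).
    rewrite a0 in e5 *; apply: Or31; split=> //; apply: sqrf_eq0P.
    by apply: (mulfI y0); lincomb (gap e5).
  have aE : a = -1 by lincomb (gap a1).
  rewrite aE in e5 *; apply: Or32; split=> //.
  have h : d + 1 = 0.
    by apply: sqrf_eq0P; apply: (mulfI y0); lincomb (gap e5).
  by lincomb (gap h).
Qed.

(** The mixed pair [e3], [e4] is a linear system in x and y that does not involve [l]; this is
    Cramer's rule, with determinant b c (b c + (d - a)^2). *)
Lemma rota_baxter_eqs_E5_param x y l a b c d : b != 0 -> c != 0 ->
  rota_baxter_eqs 1 x y 1 l a b c d ->
  x * (b * c + (d - a) ^+ 2) = - b * (d - a + b) /\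
  y * (b * c + (d - a) ^+ 2) = c * (d - a - c).
Proof.
move=> b0 c0 [[_ _ e3] [e4 _ _]]; split.
  by apply: (mulfI c0); lincomb (- (d - a) * gap e4 - b * gap e3).
by apply: (mulfI b0); lincomb ((d - a) * gap e3 - c * gap e4).
Qed.

Lemma rota_baxter_eqs_E5_nondiag x y l a b c d :
  x * y != 1 -> b != 0 -> c != 0 ->
  rota_baxter_eqs 1 x y 1 l a b c d -> a + d = - l /\ a * d = b * c.
Proof.
move=> xy; apply: rota_baxter_eqs_nondiag.
by rewrite mul1r subr_eq0 eq_sym.
Qed.

(** For x = 0 the parametrisation forces d - a = - b, which with trace -1 gives the diagonal in
    terms of b; a d = b c then becomes the quadratic for b, the origin of the entries 1 / sqrt(1 - 4
    y). *)
Lemma rota_baxter_eqs_E5_0y y a b c d : b != 0 -> c != 0 ->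
  rota_baxter_eqs 1 0 y 1 1 a b c d ->
  [/\ y != 0, c = - y * b, a = (b - 1) / 2, d = (- b - 1) / 2
    & (1 - 4 * y) * b ^+ 2 = 1].
Proof.
move=> b0 c0 E.
have [h1 h2] : a + d = -1 /\ a * d = b * c.
  by apply: rota_baxter_eqs_E5_nondiag E; rewrite // mul0r eq_sym oner_eq0.
have [hx _] := rota_baxter_eqs_E5_param b0 c0 E.
case: E => [_ [e4 _ _]].
have g : d - a + b = 0 by apply: (mulfI b0); lincomb (gap hx).
have cE : c = - y * b by apply: (mulfI b0); lincomb (- gap e4).
have aE : 2 * a = b - 1 by lincomb (gap h1 - gap g).
have dE : 2 * d = - b - 1 by lincomb (gap h1 + gap g).
split; rewrite ?(eq_divf n2 aE) ?(eq_divf n2 dE) //.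
  by apply: contra_neq c0 => y0; rewrite cE y0 oppr0 mul0r.
lincomb (2 * d * gap aE + (b - 1) * gap dE - 4 * b * gap cE
  - 4 * gap h2).
Qed.

Lemma rota_baxter_eqs_E6_upper0 x a b d : rota_baxter_eqs 0 1 1 x 0 a b 0 d ->
  [/\ a = 0, b = 0 & d = 0].
Proof.
move=> [[e1 e2 _] [_ e5 _]].
have b0 : b = 0 by apply: sqrf_eq0P; lincomb (gap e1).
rewrite b0 in e2.
have [a0|h] : a = 0 \/ a - 2 * d = 0 by apply: mulf_eq0P; lincomb (gap e2).
  by split=> //; apply: sqrf_eq0P; rewrite a0 in e5; lincomb (gap e5).
have d0 : d = 0.
  by apply: sqrf_eq0P; apply: (mulfI n3); lincomb (- gap e5 - 2 * d * gap h).
by split=> //; lincomb (gap h + 2 * gap d0).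
Qed.

(** Once b = 0, the equations [e2] and [e5] are exchanged by a and d, and their difference factors
    as (a - d)(a + d + 1) = 0. *)
Lemma rota_baxter_eqs_E6_upper1 x a b d : rota_baxter_eqs 0 1 1 x 1 a b 0 d ->
  b = 0 /\ [\/ a = 0 /\ d = 0, a = -1 /\ d = -1 |
    [/\ x = 0, d = -1 - a & 3 * a ^+ 2 + 3 * a + 1 = 0]].
Proof.
move=> [[e1 e2 _] [_ e5 e6]].
have b0 : b = 0 by apply: sqrf_eq0P; lincomb (gap e1).
rewrite b0 in e2 e5 e6; split=> //.
have diag : a = d -> a = 0 \/ a + 1 = 0.
  by move=> ad; rewrite -ad in e2; apply: mulf_eq0P; lincomb (- gap e2).
have [ad|h] : a - d = 0 \/ a + d + 1 = 0.
  by apply: mulf_eq0P; lincomb (gap e2 - gap e5).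
- have ad' : a = d by lincomb (gap ad).
  rewrite -ad'; have [a0|a1] := diag ad'; first by apply: Or31.
  by apply: Or32; split; lincomb (gap a1).
- have dE : d = -1 - a by lincomb (gap h).
  have q : 3 * a ^+ 2 + 3 * a + 1 = 0.
    by rewrite dE in e2; lincomb (gap e2).
  have [x0|] := eqVneq x 0; first by apply: Or33.
  move=> x0; have h' : d ^+ 2 + d = 0.
    by apply: (mulfI x0); lincomb (- gap e6).
  (* Here d^2 + d = a^2 + a, so a nonzero x would kill all of 3 (a^2 + a) + 1 except the 1. *)
  have : (1 : K) = 0.
    rewrite dE in h'; lincomb (gap q - 3 * gap h').
  by move/eqP; rewrite oner_eq0.
Qed.

(** [e1] gives a, [e1] with [e4] gives trace [- l], [e3] gives x, and [e2] becomes the quartic.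
    Keeping [l] serves both weights. *)
Lemma rota_baxter_eqs_E6 x l a b c d : c != 0 ->
  rota_baxter_eqs 0 1 1 x l a b c d ->
  [/\ b != 0, a = (b ^+ 2 - l * c) / (2 * c), d = (- b ^+ 2 - l * c) / (2 * c),
      x = (- b ^+ 3 - c ^+ 3) / (b * c ^+ 2)
    & b ^+ 4 + 4 * b * c ^+ 3 = l ^+ 2 * c ^+ 2].
Proof.
move=> c0 [[e1 e2 e3] [e4 _ _]].
have b0 : b != 0.
  apply: contra_neq c0 => b0; apply: sqrf_eq0P; rewrite b0 in e3.
  by lincomb (- gap e3).
have dE : a + d + l = 0.
  by apply: (mulfI c0); lincomb (- gap e1 - gap e4).
have xE : x * (b * c ^+ 2) = - b ^+ 3 - c ^+ 3.
  lincomb (- c * gap e3 + b * gap e1 + b * c * gap dE).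
have aE : 2 * c * a = b ^+ 2 - l * c by lincomb (- gap e1).
have dE' : 2 * c * d = - b ^+ 2 - l * c by lincomb (2 * c * gap dE - gap aE).
split=> //.
- by apply: eq_divf; rewrite ?mulf_neq0.
- by apply: eq_divf; rewrite ?mulf_neq0.
- by apply: eq_divf; rewrite ?mulf_neq0 ?expf_neq0 // mulrC.
- lincomb (- (4 * c ^+ 2 * gap e2) + 4 * b * gap xE
    + (2 * c * a + (b ^+ 2 - l * c) + 2 * (b ^+ 2 + l * c)) * gap aE
    - (4 * c * a + 2 * c * l) * gap dE').
Qed.

End Solutions.

(** * The listed matrices satisfy the equations *)

Definition structure_eqs (R : realType) (l : R[i]) (E : evolution_algebra R)
    (M : 'M[R[i]]_2) : Prop :=
  let A := structure_mx E in
  rota_baxter_eqs (A 0 0) (A 0 1) (A 1 0) (A 1 1) l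
    (M 0 0) (M 0 1) (M 1 0) (M 1 1).

Lemma weight0_sound (R : realType) (E : evolution_algebra R) (M : 'M[R[i]]_2) :
  weight0_list E M -> structure_eqs 0 E M.
Proof.
have i2 := @sqrCi R[i].
case=> [b d|c|c|a|a|b d|a b|a|a|a b a0 b0 _ _ _|b c b0 c0 h1 h2];
  rewrite /structure_eqs /= !mx2E.
- by split; split; ring.
- by split; split; ring: i2.
- by split; split; ring: i2.
- by split; split; ring.
- by split; split; ring.
- by split; split; ring.
- by split; split; field.
- by split; split; field.
- by split; split; field.
- by split; split; field; rewrite ?a0 ?b0 ?pnatr_eq0.
- have h : b ^+ 3 = - 4 * c ^+ 3.
    move/(congr1 ( *%R^~ c)): h2; rewrite mul0r mulrDl divfK // => h2.
    lincomb (gap h2).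
  by split; split; field: h; rewrite ?b0 ?c0 ?pnatr_eq0.
Qed.

(** For t = pi / 6 the angles 2 t and t are complementary, so cos 2t = sin t is a quadratic in sin
    t; positivity discards the root -1. *)
Lemma sin_pi6 (R : realType) : sin (pi / 6) = 1 / 2 :> R.
Proof.
set t : R := pi / 6.
have pos : 0 < sin t.
  apply: sin_gt0_pi; have := pi_gt0 R; rewrite /t => h; by lra.
have e : sin t = 1 - 2 * sin t ^+ 2.
  have : cos (t *+ 2) = sin t.
    by rewrite -cosBpihalf -cosN; congr (cos _); rewrite /t; field => //.
  by rewrite cos_mulr2n; have := cos2Dsin2 t; lra.
have : (2 * sin t - 1) * (sin t + 1) = 0 by lra.
move/eqP; rewrite mulf_eq0 => /orP[]/eqP h; lra.
Qed.

(** The roots of z^2 - i z - 1 are omega and omega^5 = i - omega. All later identities in omega,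
    such as omega^3 = i, are reduced by this relation. *)
Lemma omega_sqr (R : realType) : omega R ^+ 2 = 'i * omega R + 1.
Proof.
have h := sin_pi6 R.
have c2 : cos (pi / 6) ^+ 2 = 3 / 4 :> R.
  have := cos2Dsin2 (pi / 6 : R); rewrite h; lra.
rewrite -complexiE /omega h expr2; apply/eqP; rewrite eq_complex /=.
by apply/andP; split; apply/eqP; rewrite -?expr2 ?c2; field.
Qed.

Lemma weight1_sound (R : realType) (E : evolution_algebra R) (M : 'M[R[i]]_2) :
  weight1_list E M -> structure_eqs 1 E M.
Proof.
have i2 := @sqrCi R[i].
have s2 : sqrtC 3 ^+ 2 = 3 :> R[i] by exact: sqrtCK.
have s0 : sqrtC 3 != 0 :> R[i] by rewrite sqrtC_eq0 pnatr_eq0.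
have w2 := omega_sqr R.
have w5 : omega R ^+ 5 = 'i - omega R by ring: i2 w2.
have n2 : (2 : R[i]) != 0 by rewrite pnatr_eq0.
have n4 : (4 : R[i]) != 0 by rewrite pnatr_eq0.
(* Expressing y through s = sqrt(1 - 4 y) makes the listed entries rational in s, within reach of
   [field]. *)
have disc (y : R[i]) : y != 1 / 4 ->
    sqrtC (1 - 4 * y) != 0 /\ y = (1 - sqrtC (1 - 4 * y) ^+ 2) / 4.
  move=> y0; split; last by rewrite sqrtCK; field.
  rewrite sqrtC_eq0; apply: contra_neq y0 => e.
  apply: (mulfI n4); rewrite mul1r divff //; lincomb (- gap e).
have root (y c : R[i]) : c = (1 + sqrtC (1 - 4 * y)) / 2 \/
    c = (1 - sqrtC (1 - 4 * y)) / 2 -> y = c - c ^+ 2.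
  have := sqrtCK (1 - 4 * y); set s := sqrtC _ => e.
  have -> : y = (1 - s ^+ 2) / 4 by rewrite e; field.
  by case=> ->; field.
have rootN (y c : R[i]) : c = (-1 + sqrtC (1 - 4 * y)) / 2 \/
    c = (-1 - sqrtC (1 - 4 * y)) / 2 -> y = - c - c ^+ 2.
  have := sqrtCK (1 - 4 * y); set s := sqrtC _ => e.
  have -> : y = (1 - s ^+ 2) / 4 by rewrite e; field.
  by case=> ->; field.
case=> [d|d|c|c|||c|c|b|b|b|b|a b a0|y|y c /rootN ->|y y0|y c y0 /root -> _
    |y y0 /disc[]|y y0 /disc[]|x|x b /root -> _|x b /root -> _|x
    |x x0 /disc[]|x x0 /disc[]||x y|x _ _|x _ _|c d d0 d1 dp dm c0 _ _
    |||||||||x|b c b0 c0 _ _ h];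
  rewrite /structure_eqs /= !mx2E ?w5.
1-2: by split; split; ring.
1-2: by split; split; ring: i2.
1-2: by split; split; field: i2.
1-2: by split; split; ring: i2.
1-4: by split; split; ring.
- have a1 : 1 + 2 * a != 0.
    by apply: contra_neq a0 => e; apply: (mulfI n2);
      rewrite mulrN mul1r divff //; lincomb (gap e).
  by split; split; field; rewrite ?a1.
1-4: by split; split; ring.
1-2: move: (sqrtC (1 - 4 * y)) => s sn0 yE;
  rewrite (_ : 8 * y - 2 = - 2 * s ^+ 2) yE; last by field.
1-2: by split; split; field; rewrite ?sn0 ?n2.
1-4: by split; split; ring.
1-2: move: (sqrtC (1 - 4 * x)) => s sn0 xE;
  rewrite (_ : 8 * x - 2 = - 2 * s ^+ 2) xE; last by field.
1-2: by split; split; field; rewrite ?sn0 ?n2.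
1-2: by split; split; ring.
1-2: by split; split; field: i2 s2; rewrite ?s0.
(* The two excluded values of d are exactly the roots of this denominator. *)
- have k0 : 1 + 3 * d + 3 * d ^+ 2 != 0.
    rewrite -subr_eq0 in dp; rewrite -subr_eq0 in dm.
    apply: contra_neq (mulf_neq0 dp dm) => e.
    transitivity ((1 + 3 * d + 3 * d ^+ 2) / 3); last by rewrite e mul0r.
    by field: i2 s2.
  by split; split; field; rewrite ?c0 ?k0.
1-2: by split; split; field: i2 s2.
1-2: by split; split; field: i2 s2; rewrite ?s0.
1-4: by split; split; field: i2 s2 w2; rewrite ?s0.
- by split; split; ring.
- have h' : b ^+ 4 = c ^+ 2 - 4 * b * c ^+ 3.
    move/(congr1 ( *%R^~ c)): h; rewrite mulrDl divfK // => h.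
    lincomb (gap h).
  by split; split; field: h'; rewrite ?b0 ?c0 ?n2.
Qed.

(** * Completeness in weight 0 *)

Lemma sqr_add_i (R : realType) (c d : R[i]) : c ^+ 2 + d ^+ 2 = 0 ->
  d = - 'i * c \/ d = 'i * c.
Proof.
move=> h; have i2 := @sqrCi R[i].
have [] : d = 'i * c \/ d = - ('i * c).
- by apply: eqf_sqrP; lincomb (gap h - c ^+ 2 * gap i2).
- by right.
- by rewrite -mulNr; left.
Qed.

Lemma weight0_complete (R : realType) (E : evolution_algebra R)
    (M : 'M[R[i]]_2) : admissible E -> structure_eqs 0 E M ->
  weight0_list E M \/ M = 0.
Proof.
have n2 : (2 : R[i]) != 0 by rewrite pnatr_eq0.
have n3 : (3 : R[i]) != 0 by rewrite pnatr_eq0.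
rewrite [M]mx2_eta /structure_eqs !mx2E.
move: (M 0 0) (M 0 1) (M 1 0) (M 1 1) => a b c d {M}.
case: E => [||||x y|x] /= adm; rewrite ?mx2E => eqs.
- case: eqs => -[e1 e2 e3] [e4 e5 e6].
  have -> : a = 0 by apply: sqrf_eq0P; lincomb (- gap e1).
  have -> : c = 0 by apply: sqrf_eq0P; lincomb (gap e5).
  by left; constructor.
- case: eqs => -[e1 e2 e3] [e4 e5 e6].
  have [a0 b0] : a = 0 /\ b = 0.
    have [a0|b0] : 2 * a = 0 \/ b = 0 by apply: mulf_eq0P; lincomb (- gap e2).
      have a0' : a = 0 by apply: (mulfI n2); lincomb (gap a0).
      by split=> //; apply: sqrf_eq0P; rewrite a0' in e1; lincomb (gap e1).
    by split=> //; apply: sqrf_eq0P; rewrite b0 in e1; lincomb (- gap e1).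
  rewrite a0 b0 in e5 *.
  have [->|->] : d = - 'i * c \/ d = 'i * c.
    by apply: sqr_add_i; lincomb (gap e5).
  + by left; apply: W0_E2_1.
  + by left; apply: W0_E2_2.
- left; have [] := rota_baxter_eqs_E3 eqs; rewrite ?oppr0 ?sub0r ?add0r.
  + by case=> -> -> ->; rewrite -{2 3}[b]opprK; constructor.
  + by case=> -> -> ->; rewrite -{2 3}[b]opprK; constructor.
  + by case=> -> -> ->; constructor.
  + by case=> -> -> ->; constructor.
- case: eqs => -[e1 e2 e3] [e4 e5 e6].
  have -> : c = 0 by apply: sqrf_eq0P; lincomb (- gap e3).
  have [->|h] : a = 0 \/ a - 2 * d = 0 by apply: mulf_eq0P; lincomb (gap e2).
    by left; apply: W0_E4_1.
  have -> : d = a / 2 by apply: eq_divf => //; lincomb (- gap h).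
  by left; apply: W0_E4_2.
- have [c0|c0] := eqVneq c 0.
    right.
    rewrite c0 in eqs *.
    by have [-> -> ->] := rota_baxter_eqs_E5_upper0 eqs; rewrite mx2_0.
  have [b0|b0] := eqVneq b 0.
    right; rewrite b0 in eqs *.
    have [-> -> ->] := rota_baxter_eqs_E5_upper0 (rota_baxter_eqs_swap eqs).
    by rewrite mx2_0.
  have [h1 h2] := rota_baxter_eqs_E5_nondiag adm b0 c0 eqs.
  have [hx hy] := rota_baxter_eqs_E5_param b0 c0 eqs.
  have dE : d = - a by lincomb (gap h1).
  rewrite {}dE in h2 hx hy *.
  have cE : c = - (a ^+ 2 / b).
    by rewrite -mulNr; apply: eq_divf => //; lincomb (- gap h2).
  have a0 : a != 0.
    by apply: contra_neq c0 => a0; rewrite cE a0 expr0n mul0r oppr0.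
  have xE : x = (2 * a - b) * b / (3 * a ^+ 2).
    apply: eq_divf; first by rewrite mulf_neq0 ?expf_neq0.
    by lincomb (gap hx + x * gap h2).
  have yE : y = (- a ^+ 2 + 2 * a * b) / (3 * b ^+ 2).
    apply: eq_divf; first by rewrite mulf_neq0 ?expf_neq0.
    apply: (mulfI (expf_neq0 2 a0)).
    lincomb (b ^+ 2 * gap hy
      + (b ^+ 2 * y + 2 * a * b + b * c - a ^+ 2) * gap h2).
  (* The numerator of y vanishes at a = 2 b and that of x at b = 2 a: these are the two separate
     [E5] items. *)
  left; have [ab|ab] := eqVneq a (2 * b).
    have -> : x = 1 / 4 by rewrite xE ab; field.
    have -> : y = 0 by rewrite yE ab; field.
    have -> : c = - 2 * a by rewrite cE ab; field.
    have -> : b = a / 2 by rewrite ab; field.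
    exact: W0_E5_1.
  have [ba|ba] := eqVneq b (2 * a).
    have -> : x = 0 by rewrite xE ba; field.
    have -> : y = 1 / 4 by rewrite yE ba; field.
    have -> : c = - (a / 2) by rewrite cE ba; field.
    rewrite ba; exact: W0_E5_2.
  rewrite cE xE yE; apply: W0_E5_3 => //.
  (* At a = - b both x and y equal -1, so x y = 1. *)
  apply: contra_neq adm => aN.
  by rewrite xE yE aN; field.
- have [c0|c0] := eqVneq c 0.
    right.
    rewrite c0 in eqs *.
    by have [-> -> ->] := rota_baxter_eqs_E6_upper0 eqs; rewrite mx2_0.
  have [b0 -> -> -> h] := rota_baxter_eqs_E6 c0 eqs.
  have h' : b ^+ 3 = - 4 * c ^+ 3 by apply: (mulfI b0); lincomb (gap h).
  left; rewrite !mul0r !subr0.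
  (* Modulo [h'], both expressions for x equal 3 c / b. *)
  rewrite (_ : (_ / _) = - (3 * b ^+ 2 / (4 * c ^+ 2))).
    apply: W0_E6 => //; field: h'; by rewrite ?c0.
  by field: h'; rewrite ?b0 ?c0.
Qed.

(** * Completeness in weight 1 *)

Lemma sub_sqr_root (C : numClosedFieldType) (y c : C) : y = c - c ^+ 2 ->
  c = (1 + sqrtC (1 - 4 * y)) / 2 \/ c = (1 - sqrtC (1 - 4 * y)) / 2.
Proof.
move=> yE; have n2 : (2 : C) != 0 by rewrite pnatr_eq0.
have s2 := sqrtCK (1 - 4 * y).
have [h|h] : 2 * c - 1 = sqrtC (1 - 4 * y) \/ 2 * c - 1 = - sqrtC (1 - 4 * y).
- by apply: eqf_sqrP; lincomb (4 * gap yE - gap s2).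
- by left; apply: eq_divf => //; lincomb (gap h).
- by right; apply: eq_divf => //; lincomb (gap h).
Qed.

Lemma opp_sub_sqr_root (C : numClosedFieldType) (y c : C) : y = - c - c ^+ 2 ->
  c = (-1 + sqrtC (1 - 4 * y)) / 2 \/ c = (-1 - sqrtC (1 - 4 * y)) / 2.
Proof.
move=> yE; have /sub_sqr_root[] : y = - c - (- c) ^+ 2 by rewrite sqrrN.
- by move=> h; right; apply: oppr_inj; rewrite h; field.
- by move=> h; left; apply: oppr_inj; rewrite h; field.
Qed.

(** Brings the listed diagonals to the shape (b - 1) / 2, (- b - 1) / 2 found when solving, with b =
    1 / s or - 1 / s. *)
Lemma discr_entries (K : numFieldType) (s y : K) :
  s != 0 -> s ^+ 2 = 1 - 4 * y ->
  (1 - 4 * y + s) / (8 * y - 2) = (- (1 / s) - 1) / 2 /\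
  (1 - 4 * y - s) / (8 * y - 2) = (1 / s - 1) / 2.
Proof.
move=> s0 s2; have -> : 8 * y - 2 = - 2 * s ^+ 2 by rewrite s2; ring.
rewrite -s2.
by split; field.
Qed.

(** [e2] reads (2 a + 1) b = 0. If b = 0, the last pair makes c^2 + d^2 or c^2 + (d + 1)^2 vanish;
    otherwise a = -1/2 and b^2 = -1/4. *)
Lemma weight1_E2_complete (R : realType) (a b c d : R[i]) :
  rota_baxter_eqs 1 0 1 0 1 a b c d ->
  weight1_list E2 (mx2 a b c d).
Proof.
have n2 : (2 : R[i]) != 0 by rewrite pnatr_eq0.
have i2 := @sqrCi R[i].
move=> [[e1 e2 e3] [e4 e5 e6]].
have [b0|b0] := eqVneq b 0.
  rewrite b0 in e1 *.
  have [a0|a1] : a = 0 \/ a + 1 = 0 by apply: mulf_eq0P; lincomb (- gap e1).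
    rewrite a0 in e5 *.
    have [->|->] : d = - 'i * c \/ d = 'i * c.
      by apply: sqr_add_i; lincomb (gap e5).
    + exact: W1_E2_2.
    + exact: W1_E2_1.
  have aE : a = -1 by lincomb (gap a1).
  rewrite aE in e5 *.
  have [h|h] : d + 1 = - 'i * c \/ d + 1 = 'i * c.
    by apply: sqr_add_i; lincomb (gap e5).
  + have -> : d = -1 - 'i * c by lincomb (gap h).
    exact: W1_E2_6.
  + have -> : d = -1 + 'i * c by lincomb (gap h).
    exact: W1_E2_5.
have aE : a = - (1 / 2).
  rewrite -mulNr; apply: eq_divf => //; apply: (mulfI b0); lincomb (- gap e2).
have a2 : 2 * a + 1 = 0 by rewrite aE; field.
have dE : d = a by apply: (mulfI b0); lincomb (gap e3).
have cE : c = - b by apply: (mulfI b0); lincomb (- gap e4).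
have [h|h] : 2 * b = 'i \/ 2 * b = - 'i.
  by apply: eqf_sqrP; lincomb (4 * gap e1 + (2 * a + 1) * gap a2 - gap i2).
- have bE : b = 'i / 2 by exact: eq_divf.
  rewrite dE cE bE aE; exact: W1_E2_3.
- have bE : b = - ('i / 2) by rewrite -mulNr; exact: eq_divf.
  rewrite dE cE bE aE opprK; exact: W1_E2_4.
Qed.

Lemma weight1_E5_complete (R : realType) (x y a b c d : R[i]) :
  x * y != 1 -> rota_baxter_eqs 1 x y 1 1 a b c d ->
  [\/ weight1_list (E5 x y) (mx2 a b c d), mx2 a b c d = 0
    | weight1_list_swapped (E5 x y) (mx2 a b c d)].
Proof.
have n2 : (2 : R[i]) != 0 by rewrite pnatr_eq0.
have n3 : (3 : R[i]) != 0 by rewrite pnatr_eq0.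
have i2 := @sqrCi R[i].
have s2 : sqrtC 3 ^+ 2 = 3 :> R[i] by exact: sqrtCK.
have s0 : sqrtC 3 != 0 :> R[i] by rewrite sqrtC_eq0.
move=> adm eqs.
have [c0|c0] := eqVneq c 0.
  rewrite c0 in eqs *.
  have [[-> -> ->]|[-> -> ->]|[y0 h]] := rota_baxter_eqs_E5_upper1 eqs.
  - by apply: Or32; rewrite mx2_0.
  - by apply: Or31; apply: W1_E5_xy.
  rewrite y0; apply: Or31.
  case: h => [[-> -> ->]|[-> -> xE]|[-> -> xE]|[-> -> ->]].
  - exact: W1_E5_x0_1.
  - have [b0|b0] := eqVneq b 0.
      (* The diagonal matrix (0, -1) on [E5 0 0] occurs only in the [E5 0 y] item, with y = 0 and
         the root (-1 + 1) / 2 = 0. *)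
      rewrite xE b0 expr0n subr0; apply: W1_E5_0y_2; left.
      by rewrite mulr0 subr0 sqrtC1 addNr mul0r.
    by apply: W1_E5_x0_2 => //; exact: sub_sqr_root.
  - have [b0|b0] := eqVneq b 0.
      by rewrite xE b0 expr0n subr0 oppr0; exact: W1_E5_00.
    rewrite -[b]opprK; apply: W1_E5_x0_3; rewrite ?oppr_eq0 //.
    by apply: sub_sqr_root; rewrite sqrrN.
  - exact: W1_E5_x0_4.
have [b0|b0] := eqVneq b 0.
  rewrite b0 in eqs *.
  have [[-> c0' ->]|[-> c0' ->]|[x0 h]] :=
    rota_baxter_eqs_E5_upper1 (rota_baxter_eqs_swap eqs).
  - by rewrite c0' eqxx in c0.
  - by rewrite c0' eqxx in c0.
  rewrite x0; case: h => [[-> -> ->]|[-> -> yE]|[-> -> yE]|[-> -> ->]].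
  - by apply: Or31; exact: W1_E5_0y_1.
  - have [y0|y0] := eqVneq y 0.
      (* At y = 0 the nonzero root of c - c^2 is 1, and the [E5 0 y] item with this shape requires y
         nonzero. *)
      rewrite y0; apply: Or33; have -> : c = 1; last by constructor.
      by apply: (mulfI c0); rewrite y0 in yE; lincomb (gap yE).
    by apply: Or31; apply: W1_E5_0y_4 => //; exact: sub_sqr_root.
  - by apply: Or31; apply: W1_E5_0y_2; exact: opp_sub_sqr_root.
  - have [->|y0] := eqVneq y 0; first by apply: Or33; constructor.
    by apply: Or31; exact: W1_E5_0y_3.
apply: Or31.
have [x0|x0] := eqVneq x 0.
  rewrite x0 in eqs *.
  have [y0 cE -> -> h] := rota_baxter_eqs_E5_0y b0 c0 eqs; rewrite {}cE.
  have v1 : 1 - 4 * y != 0.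
    by apply/eqP => v1; move/eqP: h; rewrite v1 mul0r eq_sym oner_eq0.
  have v4 : y != 1 / 4.
    by apply: contra_neq v1 => ->; rewrite mul1r divff ?subrr.
  have t2 := sqrtCK (1 - 4 * y).
  have t0 : sqrtC (1 - 4 * y) != 0 by rewrite sqrtC_eq0.
  have [aE dE] := discr_entries t0 t2.
  have [h'|h'] : sqrtC (1 - 4 * y) * b = 1 \/ sqrtC (1 - 4 * y) * b = -1.
    by apply: eqf_sqrP; lincomb (gap h + b ^+ 2 * gap t2).
  + rewrite (eq_divf t0 h') -aE -dE mulrA mulr1 mulNr; exact: W1_E5_0y_6.
  + have -> : b = - (1 / sqrtC (1 - 4 * y)) by rewrite -mulNr; exact: eq_divf.
    rewrite opprK -aE -dE mulrNN mulrA mulr1; exact: W1_E5_0y_5.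
have [y0|y0] := eqVneq y 0.
  rewrite y0 in eqs *.
  have [_ bE -> -> h] :=
    rota_baxter_eqs_E5_0y c0 b0 (rota_baxter_eqs_swap eqs).
  rewrite {}bE.
  have v1 : 1 - 4 * x != 0.
    by apply/eqP => v1; move/eqP: h; rewrite v1 mul0r eq_sym oner_eq0.
  have v4 : x != 1 / 4.
    by apply: contra_neq v1 => ->; rewrite mul1r divff ?subrr.
  have t2 := sqrtCK (1 - 4 * x).
  have t0 : sqrtC (1 - 4 * x) != 0 by rewrite sqrtC_eq0.
  have [aE dE] := discr_entries t0 t2.
  have [h'|h'] : sqrtC (1 - 4 * x) * c = 1 \/ sqrtC (1 - 4 * x) * c = -1.
    by apply: eqf_sqrP; lincomb (gap h + c ^+ 2 * gap t2).
  + rewrite (eq_divf t0 h') -aE -dE mulrA mulr1 mulNr; exact: W1_E5_x0_5.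
  + have -> : c = - (1 / sqrtC (1 - 4 * x)) by rewrite -mulNr; exact: eq_divf.
    rewrite opprK -aE -dE mulrNN mulrA mulr1; exact: W1_E5_x0_6.
have [h1 h2] := rota_baxter_eqs_E5_nondiag adm b0 c0 eqs.
have [hx hy] := rota_baxter_eqs_E5_param b0 c0 eqs.
have aE : a = - 1 - d by lincomb (gap h1).
rewrite {}aE in h2 hx hy eqs *; clear h1.
have bE : b = - (d * (1 + d) / c).
  by rewrite -mulNr; apply: eq_divf => //; lincomb (- gap h2).
(* This is the factor of x and y in [hx] and [hy] once b c = - d (1 + d). Where it vanishes they
   yield c = - b = 1 + 2 d instead, and [e3] then reads x + y = 1. *)
have [k0|k0] := eqVneq (1 + 3 * d + 3 * d ^+ 2) 0.
  have k' : 3 * (1 + 2 * d) ^+ 2 = - 1 by lincomb (4 * gap k0).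
  have b' : b = - (1 + 2 * d).
    apply: (mulfI b0); lincomb (gap hx - x * gap k0 + x * gap h2).
  have c' : c = 1 + 2 * d.
    apply: (mulfI c0); lincomb (gap hy - y * gap k0 + y * gap h2).
  have yE : y = 1 - x.
    case: eqs => [[_ _ e3] _]; rewrite b' c' in e3; rewrite c' in c0.
    by apply: (mulfI (expf_neq0 2 c0)); lincomb (- gap e3).
  have [h|h] : sqrtC 3 * (1 + 2 * d) = 'i \/ sqrtC 3 * (1 + 2 * d) = - 'i.
    apply: eqf_sqrP; lincomb (gap k' + (1 + 2 * d) ^+ 2 * gap s2 - gap i2).
  + have dE : d = (- 3 + 'i * sqrtC 3) / 6.
      apply: eq_divf; first by rewrite pnatr_eq0.
      by lincomb (sqrtC 3 * gap h - (1 + 2 * d) * gap s2).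
    rewrite b' c' (eq_divf s0 h).
    have -> : -1 - d = (- 3 - 'i * sqrtC 3) / 6 by rewrite dE; field.
    (* The excluded values of x are the roots of x (1 - x) = 1. *)
    rewrite dE yE; apply: W1_E5_diag_1.
    * by apply: contra_neq adm => xE; rewrite yE xE; field: i2 s2.
    * by apply: contra_neq adm => xE; rewrite yE xE; field: i2 s2.
  + have dE : d = (- 3 - 'i * sqrtC 3) / 6.
      apply: eq_divf; first by rewrite pnatr_eq0.
      by lincomb (sqrtC 3 * gap h - (1 + 2 * d) * gap s2).
    have uE : 1 + 2 * d = - ('i / sqrtC 3) by rewrite -mulNr; exact: eq_divf.
    rewrite b' c' uE opprK.
    have -> : -1 - d = (- 3 + 'i * sqrtC 3) / 6 by rewrite dE; field.
    rewrite dE yE; apply: W1_E5_diag_2.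
    * by apply: contra_neq adm => xE; rewrite yE xE; field: i2 s2.
    * by apply: contra_neq adm => xE; rewrite yE xE; field: i2 s2.
have u0 : c != 1 + 2 * d.
  apply: contra_neq y0 => cE.
  apply: (mulfI k0);
  lincomb (gap hy + y * gap h2 - c * gap cE).
have xE : x = d * (1 + d) * (c + 2 * c * d - d * (1 + d))
             / (c ^+ 2 * (1 + 3 * d + 3 * d ^+ 2)).
  apply: eq_divf; first by rewrite mulf_neq0 ?expf_neq0.
  lincomb (c ^+ 2 * gap hx
    + (c ^+ 2 * x + c * (1 + 2 * d) + b * c - d * (1 + d)) * gap h2).
have yE : y = c * (1 - c + 2 * d) / (1 + 3 * d + 3 * d ^+ 2).
  apply: eq_divf => //; lincomb (gap hy + y * gap h2).
have bc0 : b * c != 0 by rewrite mulf_neq0.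
rewrite bE yE xE; apply: W1_E5_gen => //.
- by apply: contra_neq bc0 => d0; rewrite -h2 d0 mulr0.
- by apply: contra_neq bc0 => d0; rewrite -h2 d0 subrr mul0r.
- by apply: contra_neq k0 => ->; field: i2 s2.
- by apply: contra_neq k0 => ->; field: i2 s2.
(* If 1 + 2 d = 0 the quotient is 0 by convention and [c0] concludes. Otherwise equality would make
   the numerator of x vanish. *)
- have [u1|u1] := eqVneq (1 + 2 * d) 0.
    by rewrite u1 invr0 mulr0.
  apply: contra_neq x0 => cE.
  have cu : c * (1 + 2 * d) = d * (1 + d) by rewrite cE divfK.
  have bu : b = - (1 + 2 * d).
    by apply: (mulfI c0); lincomb (- gap h2 + gap cu).
  apply: (mulfI k0); lincomb (gap hx + x * gap h2 - b * gap bu).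
Qed.

(** With s = sqrt 3 and 3 b c = 1, the number v = s b determines the matrix: c is v^-1 / s, and the
    diagonal depends only on v^3. The parameters [w] and [z] let each root supply its inverse and
    cube in the listed form. *)
Lemma E6_0_entries (K : numFieldType) (s b c v w z : K) :
  s != 0 -> s ^+ 2 = 3 -> s * b = v -> 3 * b * c = 1 -> v * w = 1 ->
  v ^+ 3 = z ->
  [/\ b = v / s, c = w / s, (b ^+ 2 - 1 * c) / (2 * c) = (- 3 + z * s) / 6
    & (- b ^+ 2 - 1 * c) / (2 * c) = (- 3 - z * s) / 6].
Proof.
move=> s0 s2 <- bc vw <-.
have c0 : c != 0.
  by apply/eqP => c0; move/eqP: bc; rewrite c0 mulr0 eq_sym oner_eq0.
have cE : s * c = w.
  by lincomb (- (s * c * gap vw) + b * c * w * gap s2 + w * gap bc).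
have b2 : b ^+ 2 = (s * b) ^+ 3 * s * c / 3.
  apply: eq_divf; first by rewrite pnatr_eq0.
  by lincomb (- ((s ^+ 2 + 3) * b ^+ 3 * c * gap s2) - 3 * b ^+ 2 * gap bc).
split; [exact: eq_divf | exact: eq_divf | |].
- by rewrite b2; field.
- by rewrite b2; field.
Qed.

Lemma weight1_E6_complete (R : realType) (x a b c d : R[i]) :
  rota_baxter_eqs 0 1 1 x 1 a b c d ->
  weight1_list (E6 x) (mx2 a b c d) \/ mx2 a b c d = 0.
Proof.
have n2 : (2 : R[i]) != 0 by rewrite pnatr_eq0.
have n6 : (6 : R[i]) != 0 by rewrite pnatr_eq0.
have i2 := @sqrCi R[i].
have s2 : sqrtC 3 ^+ 2 = 3 :> R[i] by exact: sqrtCK.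
have s0 : sqrtC 3 != 0 :> R[i] by rewrite sqrtC_eq0.
have w2 := omega_sqr R.
have w3 : omega R ^+ 3 = 'i by ring: i2 w2.
have w5 : omega R ^+ 5 = 'i - omega R by ring: i2 w2.
have w15 : ('i - omega R) ^+ 3 = 'i by ring: i2 w2.
move=> eqs; have [c0|c0] := eqVneq c 0.
  rewrite c0 in eqs *.
  have [-> [[-> ->]|[-> ->]|[-> -> q]]] := rota_baxter_eqs_E6_upper1 eqs.
  - by right; rewrite mx2_0.
  - by left; exact: W1_E6_x.
  left; have [h|h] : sqrtC 3 * (1 + 2 * a) = 'i \/ sqrtC 3 * (1 + 2 * a) = - 'i.
    apply: eqf_sqrP.
    by lincomb (4 * gap q + (1 + 2 * a) ^+ 2 * gap s2 - gap i2).
  + have aE : a = (- 3 + 'i * sqrtC 3) / 6.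
      by apply: eq_divf; rewrite ?n6 //;
        lincomb (sqrtC 3 * gap h - (1 + 2 * a) * gap s2).
    have -> : -1 - a = (- 3 - 'i * sqrtC 3) / 6 by rewrite aE; field.
    rewrite aE; exact: W1_E6_0_1.
  + have aE : a = (- 3 - 'i * sqrtC 3) / 6.
      by apply: eq_divf; rewrite ?n6 //;
        lincomb (sqrtC 3 * gap h - (1 + 2 * a) * gap s2).
    have -> : -1 - a = (- 3 + 'i * sqrtC 3) / 6 by rewrite aE; field.
    rewrite aE; exact: W1_E6_0_2.
left; have [b0 -> -> -> h] := rota_baxter_eqs_E6 c0 eqs.
have [bc|bc] := eqVneq (- b ^+ 3 - c ^+ 3) 0; last first.
  (* The first listed equation is the quartic [h] times b^3 + c^3, up to division by b c, so it
     follows from [h'] as well. *)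
  have h' : b ^+ 4 = c ^+ 2 - 4 * b * c ^+ 3 by lincomb (gap h).
  rewrite !mul1r; apply: W1_E6_gen => //; field: h'; by rewrite ?b0 ?c0.
(* Here x = 0, and the quartic shrinks to 3 b c = 1. *)
rewrite bc mul0r.
have h3 : 3 * b * c = 1.
  apply: (mulfI (expf_neq0 2 c0)); lincomb (gap h + b * gap bc).
pose s : R[i] := sqrtC 3; pose o := omega R.
rewrite -/s -/o in s2 s0 w2 w3 w5 w15.
(* For v = s b, the relations b^3 = - c^3 and 3 b c = 1 give v^6 = -1. Its six roots match the six
   non-diagonal [E6 0] matrices, through v^6 + 1 = (v^2 + 1)(v^4 - v^2 + 1). *)
have s6 : (s * b) ^+ 2 * ((s * b) ^+ 2 * (s * b) ^+ 2) + 1 = 0.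
  have e6 : 27 * b ^+ 6 + 1 = 0.
    lincomb (- 27 * b ^+ 3 * gap bc
      - (9 * b ^+ 2 * c ^+ 2 + 3 * b * c + 1) * gap h3).
  by rewrite exprMn s2; lincomb (gap e6).
have E v w z sb vw v3 :=
  E6_0_entries (v := v) (w := w) (z := z) s0 s2 sb h3 vw v3.
have [h1|h1] : (s * b) ^+ 2 + 1 = 0 \/
    (s * b) ^+ 2 * (s * b) ^+ 2 - (s * b) ^+ 2 + 1 = 0.
- by apply: mulf_eq0P; lincomb (gap s6).
- have [sb|sb] : s * b = 'i \/ s * b = - 'i.
    by apply: eqf_sqrP; lincomb (gap h1 - gap i2).
  + have [||-> -> -> ->] := E 'i (- 'i) (- 'i) sb; [by ring: i2|by ring: i2|].
    rewrite !mulNr opprK; exact: W1_E6_0_4.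
  + have [||-> -> -> ->] := E (- 'i) 'i 'i sb; [by ring: i2|by ring: i2|].
    rewrite !mulNr; exact: W1_E6_0_3.
(* The quartic is (v^2 - i v - 1)(v^2 + i v - 1); the first factor has roots omega and omega^5, the
   second their negatives. *)
- have [h2|h2] : (s * b - o) * (s * b - ('i - o)) = 0 \/
      (s * b + o) * (s * b + ('i - o)) = 0.
    apply: mulf_eq0P.
    lincomb (gap h1 + (o ^+ 2 - 'i * o + 1 - 2 * (s * b) ^+ 2) * gap w2
      - (s * b) ^+ 2 * gap i2).
  + have [h4|h4] := mulf_eq0P h2.
    * have sb : s * b = o by lincomb (gap h4).
      have [||-> -> -> ->] := E o (- ('i - o)) 'i sb; [by ring: w2|exact: w3|].
      rewrite -w5 mulNr; exact: W1_E6_0_6.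
    * have sb : s * b = 'i - o by lincomb (gap h4).
      have [||-> -> -> ->] := E ('i - o) (- o) 'i sb; [by ring: w2|exact: w15|].
      rewrite -w5 mulNr; exact: W1_E6_0_7.
  + have [h4|h4] := mulf_eq0P h2.
    * have sb : s * b = - o by lincomb (gap h4).
      have [||-> -> -> ->] := E (- o) ('i - o) (- 'i) sb;
        [by ring: w2|by ring: w3|].
      rewrite -w5 !mulNr opprK; exact: W1_E6_0_5.
    * have sb : s * b = - ('i - o) by lincomb (gap h4).
      have [||-> -> -> ->] := E (- ('i - o)) o (- 'i) sb;
        [by ring: w2|by lincomb (- gap w15)|].
      rewrite -w5 !mulNr opprK; exact: W1_E6_0_8.
Qed.

Lemma weight1_complete (R : realType) (E : evolution_algebra R)
    (M : 'M[R[i]]_2) : admissible E -> structure_eqs 1 E M ->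
  [\/ weight1_list E M, M = 0 | weight1_list_swapped E M].
Proof.
rewrite [M]mx2_eta /structure_eqs !mx2E.
move: (M 0 0) (M 0 1) (M 1 0) (M 1 1) => a b c d {M}.
case: E => [||||x y|x] /= adm; rewrite ?mx2E => eqs.
- case: eqs => -[e1 e2 e3] [e4 e5 e6]; apply: Or31.
  have -> : c = 0 by apply: sqrf_eq0P; lincomb (gap e5).
  have [a0|a1] : a = 0 \/ a + 1 = 0 by apply: mulf_eq0P; lincomb (- gap e1).
    have -> : b = 0 by rewrite a0 in e2; lincomb (- gap e2).
    by rewrite a0; exact: W1_E1_2.
  have aE : a = -1 by lincomb (gap a1).
  have -> : b = 0 by rewrite aE in e2; lincomb (gap e2).
  by rewrite aE; exact: W1_E1_1.
- by apply: Or31; exact: weight1_E2_complete.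
- apply: Or31; have [] := rota_baxter_eqs_E3 eqs; case=> -> -> ->.
  + exact: W1_E3_4.
  + exact: W1_E3_2.
  + exact: W1_E3_3.
  + exact: W1_E3_1.
- case: eqs => -[e1 e2 e3] [e4 e5 e6]; apply: Or31.
  have -> : c = 0 by apply: sqrf_eq0P; lincomb (- gap e3).
  have n2 : (2 : R[i]) != 0 by rewrite pnatr_eq0.
  have a1 : 1 + 2 * a != 0.
    apply/eqP => h.
    have a0 : a = 0 by apply: sqrf_eq0P; lincomb (gap e2 + d * gap h).
    by move/eqP: h; rewrite a0 mulr0 addr0 oner_eq0.
  have -> : d = a ^+ 2 / (1 + 2 * a).
    by apply: eq_divf => //; lincomb (- gap e2).
  apply: W1_E4; apply: contra_neq a1 => ->.
  by rewrite mulrN mul1r divff // subrr.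
- exact: weight1_E5_complete.
- by have [h|h] := weight1_E6_complete eqs; [apply: Or31|apply: Or32].
Qed.

(** * Assembling both weights *)

Lemma weight1_swapped_sound (R : realType) (E : evolution_algebra R)
    (M : 'M[R[i]]_2) : weight1_list_swapped E M -> structure_eqs 1 E M.
Proof. by case; rewrite /structure_eqs /= !mx2E; split; split; ring. Qed.

(** The zero map is a separate alternative in the theorem because the lists contain it only for some
    algebras: in weight 1, no item for [E5] or [E6] does. *)
Lemma structure_eqs0 (R : realType) (l : R[i]) (E : evolution_algebra R) :
  structure_eqs l E 0.
Proof. by rewrite /structure_eqs !mxE; split; split; ring. Qed.

Lemma rota_baxter_structureE (R : realType) (l : R[i]) (E : evolution_algebra R)
    (P : {linear 'rV[R[i]]_2 -> 'rV[R[i]]_2}) :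
  rota_baxter (evolution_mul (structure_mx E)) l P <->
  structure_eqs l E (lin1_mx P).
Proof. by rewrite [structure_mx E]mx2_eta; apply/rota_baxterE/mx2_eta. Qed.

Unset Implicit Arguments.

Theorem theorem3p3 (R : realType) (E : evolution_algebra R)
  (hE : admissible E) (P : {linear 'rV[R[i]]_2 -> 'rV[R[i]]_2}) :
  (rota_baxter (evolution_mul (structure_mx E)) 0 P <->
     weight0_list E (lin1_mx P) \/ lin1_mx P = 0) /\
  (rota_baxter (evolution_mul (structure_mx E)) 1 P <->
     [\/ weight1_list E (lin1_mx P), lin1_mx P = 0
       | weight1_list_swapped E (lin1_mx P)]).
Proof.
split; split=> [/rota_baxter_structureE h|h].
- exact: weight0_complete.
- apply/rota_baxter_structureE.
  by case: h => [/weight0_sound //|->]; exact: structure_eqs0.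
- exact: weight1_complete.
- apply/rota_baxter_structureE.
  case: h => [/weight1_sound //|->|/weight1_swapped_sound //].
  exact: structure_eqs0.
Qed.
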